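(* Let $P$ be a $\mu$-reversible Markov kernel on $(E,\mathscr{E})$ satisfying a $(\Phi,\beta)$-WPI for $\Phi=\|\cdot\|_{\mathrm{osc}}^2$. For any $\varepsilon>0$, define the set $A_\varepsilon:=\{x\in E:P(x,\{x\})\ge1-\varepsilon\}$. Then for any $s>0$, $$\beta(s)\ge\beta^\star(s)\ge\sup_{\varepsilon\in(0,1)}\left\{\mu(A_\varepsilon)\big(1-s\varepsilon-\mu(A_\varepsilon)\big)\right\}.$$
   Context: $(E,\mathscr{E})$ is a measurable space whose diagonal $\{(x,x):x\in E\}$ belongs to $\mathscr{E}\otimes\mathscr{E}$, $\mu$ a probability measure on it. $L^2_0(\mu)$ is the set of real $f\in L^2(\mu)$ with $\mu(f)=0$; $\|f\|_{\mathrm{osc}}=\mathrm{ess}_\mu\sup f-\mathrm{ess}_\mu\inf f\in[0,\infty]$; $\mathcal{E}(P,f)=\langle(\mathrm{Id}-P)f,f\rangle$ in $L^2(\mu)$. $(\|\cdot\|_{\mathrm{osc}}^2,\beta)$-WPI for $P$: $\beta:(0,\infty)\to[0,\infty)$ is decreasing (non-increasing) with $\beta(s)\to0$ as $s\to\infty$, and $\|f\|_2^2\le s\,\mathcal{E}(P,f)+\beta(s)\|f\|_{\mathrm{osc}}^2$ for all $s>0$, $f\in L^2_0(\mu)$. Optimal $\beta$: $\beta^\star(s)=\sup\{\|g\|_2^2-s\,\mathcal{E}(P,g):g\in L^2_0(\mu),\ \|g\|_{\mathrm{osc}}=1\}\vee0$ for $s>0$. *)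

(* Defs.v *)
From HB Require Import structures.
From mathcomp Require Import all_boot all_order all_algebra.
From mathcomp Require Import all_classical all_reals all_analysis ess_sup_inf.

Set Implicit Arguments.
Unset Strict Implicit.
Unset Printing Implicit Defensive.
Import Order.TTheory GRing.Theory Num.Theory.
Import numFieldNormedType.Exports.

Local Open Scope classical_set_scope.
Local Open Scope ring_scope.

Section wpi.
Context (d : measure_display) (E : measurableType d) (R : realType).
Implicit Types (mu : probability E R) (P : R.-pker E ~> E) (f g : E -> R).

Definition reversible mu P : Prop :=
  forall A B : set E, measurable A -> measurable B ->
    (\int[mu]_(x in A) P x B = \int[mu]_(x in B) P x A)%E.

(* Elements of L^2 are represented by functions rather than by classes modulo
   mu-null sets; for a mu-reversible kernel, all the quantities below are
   invariant under modification of the function on a null set. *)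
Definition L20 mu : set (E -> R) :=
  [set f | f \in Lfun mu 2%:E /\ (\int[mu]_x (f x)%:E = 0)%E].

(* The difference is never of the form oo - oo: as mu is a probability and f
   is real-valued, ess_sup > -oo and ess_inf < +oo. *)
Definition osc mu f : \bar R :=
  (ess_sup mu (EFin \o f) - ess_inf mu (EFin \o f))%E.

(* If P is mu-reversible and f is in L^2(mu), f is P x-integrable for mu-almost
   every x; at the other points the value is irrelevant. *)
Definition kernel_op P f : E -> R := fun x => \int[P x]_y f y.

Definition inner mu f g : R := \int[mu]_x (f x * g x).

Definition dirichlet mu P f : R := inner mu (fun x => f x - kernel_op P f x) f.

(* Only the values of beta on ]0, +oo[ matter. When beta s = 0 and
   osc mu f = +oo, the last product is 0. *)
Definition osc_WPI mu P (beta : R -> R) : Prop :=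
  [/\ forall s : R, 0 < s -> 0 <= beta s,
      forall s t : R, 0 < s -> s <= t -> beta t <= beta s,
      beta s @[s --> +oo] --> 0 &
      forall (s : R) f, 0 < s -> L20 mu f ->
        ('N[mu]_2%:E[EFin \o f] ^+ 2 <=
           (s * dirichlet mu P f)%:E + (beta s)%:E * osc mu f ^+ 2)%E].

(* An extended real, equal to 0 when no function in L20 has oscillation 1. *)
Definition beta_star mu P (s : R) : \bar R :=
  maxe (ereal_sup [set ('N[mu]_2%:E[EFin \o g] ^+ 2
                        - (s * dirichlet mu P g)%:E)%E
                  | g in [set g | L20 mu g /\ osc mu g = 1%E]]) 0%E.

Definition sticky_set P (eps : R) : set E :=
  [set x | ((1 - eps)%:E <= P x [set x])%E].

End wpi.

(* Main.v *)
Require Import Defs.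
From mathcomp Require Import all_boot all_order all_algebra.
From mathcomp Require Import all_classical all_reals all_analysis ess_sup_inf.
From mathcomp Require Import measurable_realfun ring.

Set Implicit Arguments.
Unset Strict Implicit.
Unset Printing Implicit Defensive.
Import Order.TTheory GRing.Theory Num.Theory.
Import numFieldNormedType.Exports.

Local Open Scope classical_set_scope.
Local Open Scope ring_scope.

(* For A the sticky set and p = mu A in ]0, 1[, the centred indicator 1_A - p
   has oscillation 1 and squared norm p (1 - p). Its Dirichlet energy is the
   integral over A of P x (~` A), hence at most eps p since P x [set x] is at
   least 1 - eps on A. *)

(** * Bounded functions and indicators under a finite measure *)

Section indicators.
Context (d : measure_display) (E : measurableType d) (R : realType).

(** Settles the integrability side conditions below: the functions involved are bounded, and [mu]
    and [P x] are finite measures. *)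
Lemma ler_norm_integrable (nu : {measure set E -> \bar R}) (f : E -> R) (M : R) :
  (nu setT < +oo)%E -> measurable_fun setT f -> (forall x, `|f x| <= M) ->
  nu.-integrable setT (EFin \o f).
Proof.
move=> nuoo mf fM; apply: measurable_bounded_integrable => //.
exists M; split; first exact: num_real.
by move=> N MN x _; exact: le_trans (fM x) (ltW MN).
Qed.

Lemma norm_indic_le1 (A : set E) (x : E) : `|\1_A x : R| <= 1.
Proof. by rewrite indicE; case: (_ \in _); rewrite ?normr1 ?normr0. Qed.

Lemma integrable_indic_lty (nu : {measure set E -> \bar R}) (A : set E) :
  (nu setT < +oo)%E -> measurable A -> nu.-integrable setT (EFin \o \1_A).
Proof.
move=> nuoo mA; apply: (ler_norm_integrable (M := 1)) => //.
exact: norm_indic_le1.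
Qed.

Lemma integrable_cst_lty (nu : {measure set E -> \bar R}) (c : R) :
  (nu setT < +oo)%E -> nu.-integrable setT (EFin \o cst c).
Proof. by move=> nuoo; exact: (ler_norm_integrable (M := `|c|)). Qed.

Lemma Rintegral_indic (nu : {measure set E -> \bar R}) (A : set E) :
  measurable A -> \int[nu]_x (\1_A x : R) = fine (nu A).
Proof. by move=> mA; rewrite /Rintegral integral_indic// setIT. Qed.

Lemma Rintegral_indicB (nu : {measure set E -> \bar R}) (A : set E) (c : R) :
  (nu setT < +oo)%E -> measurable A ->
  \int[nu]_x (\1_A x - c) = fine (nu A) - c * fine (nu setT).
Proof.
move=> nuoo mA; rewrite RintegralB ?Rintegral_indic ?Rintegral_cst//.
  exact: integrable_indic_lty.
exact: integrable_cst_lty.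
Qed.

End indicators.

(** * Norm, mean and oscillation of a centred indicator *)

Section centered_indicator.
Context (d : measure_display) (E : measurableType d) (R : realType).
Variables (mu : probability E R) (A : set E).
Hypothesis mA : measurable A.
Let p := fine (mu A).

Let muT : (mu setT < +oo)%E. Proof. by rewrite probability_setT ltry. Qed.

Let fine_muT : fine (mu setT) = 1. Proof. by rewrite probability_setT. Qed.

Let muA : mu A = p%:E. Proof. by rewrite fineK// fin_num_measure. Qed.

Lemma measurable_indicB (c : R) : measurable_fun setT (fun x : E => \1_A x - c).
Proof. exact: measurable_funB. Qed.

Lemma Lnorm2_sqr (f : E -> R) : mu.-integrable setT (EFin \o (fun x => f x ^+ 2)) ->
  ('N[mu]_2%:E[EFin \o f] ^+ 2 = (\int[mu]_x (f x ^+ 2))%:E)%E.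
Proof.
move=> if2; rewrite fineK; last exact: integrable_fin_num.
have -> : (\int[mu]_x (f x ^+ 2)%:E = 'N[mu]_2%:E[EFin \o f] `^ 2)%E.
  rewrite powR_Lnorm//; apply: eq_integral => x _ /=.
  by rewrite powR_mulrn// real_normK// num_real.
have := Lnorm_ge0 mu 2%:E (EFin \o f).
case: ('N[mu]_2%:E[EFin \o f])%E => [r| |]//= r0.
  by rewrite powR_mulrn// -EFin_expe.
(* At the value [+oo] both powers are [+oo], the exponent 2 being nonzero. *)
by rewrite pnatr_eq0.
Qed.

Lemma centered_indic_sqr_integrable :
  mu.-integrable setT (EFin \o (fun x => (\1_A x - p) ^+ 2)).
Proof.
apply: (ler_norm_integrable (M := (1 + `|p|) ^+ 2)) => //.
  by apply: measurable_funX; exact: measurable_indicB.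
move=> x; rewrite normrX lerXn2r ?nnegrE ?addr_ge0//.
by rewrite (le_trans (ler_normB _ _))// lerD2r norm_indic_le1.
Qed.

(** This is the variance of a Bernoulli variable of parameter [p]. *)
Lemma Lnorm2_centered_indic :
  ('N[mu]_2%:E[EFin \o (fun x => \1_A x - p)%R] ^+ 2 = (p * (1 - p))%:E)%E.
Proof.
rewrite Lnorm2_sqr; last exact: centered_indic_sqr_integrable.
(* An indicator equals its own square, so the integrand is affine in [\1_A x]. The constant term is
   written [- - p ^+ 2] to match the rule for the integral of a difference. *)
congr EFin; transitivity (\int[mu]_x ((1 - 2 * p) * \1_A x - - p ^+ 2)).
  apply: eq_Rintegral => x _; rewrite indicE.
  by case: (_ \in _); rewrite /=; ring.
rewrite RintegralB//; last exact: integrable_cst_lty.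
  rewrite RintegralZl//; last exact: integrable_indic_lty.
  rewrite Rintegral_indic// Rintegral_cst//.
  by rewrite fine_muT -/p; ring.
apply: (ler_norm_integrable (M := `|1 - 2 * p|)) => //.
  exact: measurable_funM.
by move=> x; rewrite normrM ler_piMr// norm_indic_le1.
Qed.

Lemma centered_indic_L20 : L20 mu (fun x => \1_A x - p).
Proof.
split; last first.
  have ig : mu.-integrable setT (EFin \o (fun x => \1_A x - p)%R).
    apply: (ler_norm_integrable (M := 1 + `|p|)) => //.
      exact: measurable_indicB.
    move=> x; rewrite (le_trans (ler_normB _ _))//.
    by rewrite lerD2r norm_indic_le1.
  rewrite -[LHS]fineK; last exact: integrable_fin_num.
  congr EFin; rewrite -/(Rintegral _ _ _) Rintegral_indicB//.
  by rewrite fine_muT mulr1 subrr.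
rewrite inE; apply/andP; split; rewrite inE/=; first exact: measurable_indicB.
rewrite /finite_norm.
(* The norm is finite because its square is the real number [p * (1 - p)]. *)
have := Lnorm2_centered_indic.
have := Lnorm_ge0 mu 2%:E (EFin \o (fun x => \1_A x - p)%R).
by case: ('N[mu]_2%:E[_])%E => [r| |]//= _; rewrite ltry.
Qed.

(** The values [1 - p] and [- p] are each taken on a set of positive measure, [A] and its
    complement, so neither the essential supremum nor the essential infimum can miss them. The two
    strict inequalities serve exactly this. *)
Lemma osc_centered_indic : (0 < mu A)%E -> (mu A < 1)%E ->
  osc mu (fun x => \1_A x - p) = 1%E.
Proof.
move=> mu_gt0 mu_lt1; rewrite /osc.
have p0 : 0 < p by rewrite -lte_fin -muA.
have p1 : p < 1 by rewrite -lte_fin -muA.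
have AC : mu (~` A) != 0%E.
  by rewrite probability_setC// muA -EFinB eqe subr_eq0 gt_eqF.
have -> : ess_sup mu (EFin \o (fun x => \1_A x - p)%R) = (1 - p)%:E.
  apply/eqP; rewrite eq_le; apply/andP; split.
    apply/ess_supP; apply: nearW => x /=.
    by rewrite lee_fin lerD2r (le_trans (ler_norm _))// norm_indic_le1.
  (* An essential supremum below [1 - p], the value on [A], would place [A] inside a null set. The
     essential infimum is treated in the same way with the complement of [A]. *)
  rewrite leNgt; apply/negP => /= lt1.
  have := ess_sup_ge mu (EFin \o (fun x => \1_A x - p)%R).
  move=> [N [mN N0 sub]]; move: mu_gt0; rewrite lt_neqAle => /andP[/eqP + _].
  apply; apply/esym; apply: (subset_measure0 mA mN) => // x Ax.
  apply: sub => /= /le_lt_trans /(_ lt1).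
  by rewrite indicE mem_set// ltxx.
have -> : ess_inf mu (EFin \o (fun x => \1_A x - p)%R) = (- p)%:E.
  apply/eqP; rewrite eq_le; apply/andP; split; last first.
    apply/ess_infP; apply: nearW => x /=.
    by rewrite lee_fin -[leLHS]add0r lerD2r indicE ler0n.
  rewrite leNgt; apply/negP => /= lt1.
  have := ess_inf_le mu (EFin \o (fun x => \1_A x - p)%R).
  move=> [N [mN N0 sub]]; move/eqP: AC; apply.
  apply: (subset_measure0 _ mN) => //; first exact: measurableC.
  move=> x Ax; apply: sub => /= /(lt_le_trans lt1).
  by rewrite indicE memNset// sub0r ltxx.
by rewrite -EFinB; congr EFin; ring.
Qed.

End centered_indicator.

(** * Invariance and Dirichlet energy under a reversible kernel *)

Section reversible_kernel.
Context (d : measure_display) (E : measurableType d) (R : realType).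
Variables (mu : probability E R) (P : R.-pker E ~> E).

Let PT x : (P x setT < +oo)%E. Proof. by rewrite prob_kernel ltry. Qed.

Lemma prob_kernel_le1 (x : E) (A : set E) : measurable A -> (P x A <= 1)%E.
Proof.
by move=> mA; rewrite -(prob_kernel (s := P) x); apply: le_measure; rewrite ?inE.
Qed.

Lemma prob_kernel_fin_num (x : E) (A : set E) : measurable A ->
  P x A \is a fin_num.
Proof.
move=> mA; rewrite ge0_fin_numE//.
by rewrite (le_lt_trans (prob_kernel_le1 x mA)) ?ltry.
Qed.

Lemma kernel_op_indicB (A : set E) (c : R) (x : E) : measurable A ->
  kernel_op P (fun y => \1_A y - c) x = fine (P x A) - c.
Proof.
by move=> mA; rewrite /kernel_op Rintegral_indicB// prob_kernel mulr1.
Qed.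

Lemma norm_fine_kernel_le1 (x : E) (A : set E) : measurable A ->
  `|fine (P x A)| <= 1.
Proof.
move=> mA; rewrite ger0_norm ?fine_ge0// -lee_fin fineK ?prob_kernel_le1//.
exact: prob_kernel_fin_num.
Qed.

Lemma measurable_fine_kernel (A : set E) : measurable A ->
  measurable_fun setT (fun x => fine (P x A)).
Proof. by move=> mA; apply: measurableT_comp => //; exact: measurable_kernel. Qed.

Hypothesis revP : reversible mu P.

(** Invariance of [mu]: reversibility for the pair [setT], [A] exchanges the two sets, and
    [P x setT] is 1. *)
Lemma Rintegral_kernel (A : set E) : measurable A ->
  \int[mu]_x fine (P x A) = fine (mu A).
Proof.
move=> mA; rewrite /Rintegral.
under eq_integral do rewrite fineK ?prob_kernel_fin_num//.
rewrite revP//; under eq_integral do rewrite prob_kernel.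
by rewrite integral_cst// mul1e.
Qed.

(* The energy does not see the constant c because P preserves mu. *)
Lemma dirichlet_indicB (A : set E) (c : R) : measurable A ->
  dirichlet mu P (fun x => \1_A x - c) = \int[mu]_(x in A) (1 - fine (P x A)).
Proof.
move=> mA; have muT : (mu setT < +oo)%E by rewrite probability_setT ltry.
have mh := measurable_fine_kernel mA.
have ih : mu.-integrable setT (EFin \o (fun x => fine (P x A))).
  apply: (ler_norm_integrable (M := 1)) => // x; exact: norm_fine_kernel_le1.
have i1 := integrable_indic_lty muT mA.
have i1h : mu.-integrable setT (EFin \o (fun x => \1_A x - fine (P x A))).
  apply: (ler_norm_integrable (M := 1 + 1)) => //; first exact: measurable_funB.
  move=> x; rewrite (le_trans (ler_normB _ _))// lerD ?norm_indic_le1//.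
  exact: norm_fine_kernel_le1.
rewrite /dirichlet /inner.
(* The constant cancels in the factor [f - P f] since [P x] has mass 1. It survives only in the
   other factor, where it multiplies a function of mean 0 by invariance. *)
transitivity (\int[mu]_x (\1_A x * (\1_A x - fine (P x A))
                          - c * (\1_A x - fine (P x A)))).
  by apply: eq_Rintegral => x _; rewrite kernel_op_indicB//; ring.
rewrite RintegralB//; first last.
- apply: (ler_norm_integrable (M := `|c| * (1 + 1))) => //.
    by apply: measurable_funM => //; exact: measurable_funB.
  move=> x; rewrite normrM ler_wpM2l// (le_trans (ler_normB _ _))//.
  by rewrite lerD ?norm_indic_le1// norm_fine_kernel_le1.
- apply: (ler_norm_integrable (M := 1 * (1 + 1))) => //.
    by apply: measurable_funM => //; exact: measurable_funB.
  move=> x; rewrite normrM ler_pM ?norm_indic_le1//.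
  rewrite (le_trans (ler_normB _ _))//.
  by rewrite lerD ?norm_indic_le1// norm_fine_kernel_le1.
rewrite RintegralZl// [X in c * X]RintegralB//.
rewrite Rintegral_indic// Rintegral_kernel// subrr mulr0 subr0.
(* The product vanishes off [A], and on [A] the indicator inside the difference is 1. *)
rewrite [RHS]Rintegral_mkcond; apply: eq_Rintegral => x _.
by rewrite patchE indicE; case: (_ \in _); rewrite ?mul1r ?mul0r.
Qed.

End reversible_kernel.

(** * Measurability and energy of the sticky set *)

Section sticky.
Context (d : measure_display) (E : measurableType d) (R : realType).
Variables (mu : probability E R) (P : R.-pker E ~> E).
Hypothesis mdiag : measurable (diagonal : set (E * E)).

Let xsection_diagonal (x : E) : xsection diagonal x = [set x].
Proof.
by apply/seteqP; split=> y; rewrite /xsection/= inE /diagonal/= => ->.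
Qed.

(** A singleton is a section of the diagonal, which is measurable by hypothesis. *)
Lemma measurable_diagonal_set1 (x : E) : measurable [set x].
Proof. by rewrite -xsection_diagonal; exact: measurable_xsection. Qed.

(** Through the diagonal, [P x [set x]] becomes the mass under [P x] of the section at [x] of one
    fixed measurable subset of the product, which depends measurably on [x]. The sticky set is a
    superlevel set of this function. *)
Lemma measurable_sticky_set (eps : R) : measurable (sticky_set P eps).
Proof.
have mf : measurable_fun setT (fun x => P x [set x]).
  have -> : (fun x => P x [set x]) = (fun x => P x (xsection diagonal x)).
    by apply/funext => x; rewrite xsection_diagonal.
  by apply: measurable_fun_xsection_finite_kernel; rewrite inE.
rewrite (_ : sticky_set P eps =
  [set: E] `&` [set x | ((1 - eps)%:E <= P x [set x])%E]); last by rewrite setTI.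
exact: emeasurable_fun_c_infty.
Qed.

Lemma dirichlet_sticky_le (c eps : R) : reversible mu P ->
  dirichlet mu P (fun x => \1_(sticky_set P eps) x - c)
    <= eps * fine (mu (sticky_set P eps)).
Proof.
move=> revP; have mA := measurable_sticky_set eps.
set A := sticky_set P eps in mA *.
have muT : (mu setT < +oo)%E by rewrite probability_setT ltry.
rewrite dirichlet_indicB// -Rintegral_cst//; apply: le_Rintegral => //.
- apply: (integrableS measurableT) => //.
  apply: (ler_norm_integrable (M := 1 + 1)) => //.
    by apply: measurable_funB => //; exact: measurable_fine_kernel.
  move=> x; rewrite (le_trans (ler_normB _ _))// normr1 lerD2l.
  exact: norm_fine_kernel_le1.
- by apply: (integrableS measurableT) => //; exact: integrable_cst_lty.
(* A point [x] of [A] satisfies [[set x]] included in [A], so [P x A] is at least [P x [set x]],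
   hence at least [1 - eps]. *)
- move=> x Ax; rewrite lerBlDl -lerBlDr -lee_fin fineK ?prob_kernel_fin_num//.
  apply: (le_trans Ax); apply: le_measure; rewrite ?inE//.
    exact: measurable_diagonal_set1.
  by move=> y ->.
Qed.

End sticky.

(** * Bounds on the optimal rate function *)

Section beta_star.
Context (d : measure_display) (E : measurableType d) (R : realType).
Variables (mu : probability E R) (P : R.-pker E ~> E).

(** At oscillation 1 the last term of the WPI is [beta s] itself, which bounds each element of the
    supremum. The truncation at 0 is covered by the nonnegativity of [beta]. *)
Lemma beta_star_le (beta : R -> R) (s : R) : osc_WPI mu P beta -> 0 < s ->
  (beta_star mu P s <= (beta s)%:E)%E.
Proof.
move=> [beta0 _ _ wpi] s0; rewrite /beta_star ge_max lee_fin beta0// andbT.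
apply: ge_ereal_sup => _ [g [Lg og] <-].
rewrite leeBlDl//; apply: (le_trans (wpi s g s0 Lg)).
by rewrite og -EFin_expe expr1n mule1.
Qed.

Lemma le_beta_star (s : R) (g : E -> R) : L20 mu g -> osc mu g = 1%E ->
  ('N[mu]_2%:E[EFin \o g] ^+ 2 - (s * dirichlet mu P g)%:E <= beta_star mu P s)%E.
Proof.
move=> Lg og; rewrite /beta_star le_max; apply/orP; left.
by apply: ereal_sup_ubound; exists g.
Qed.

Lemma beta_star_ge0 (s : R) : (0 <= beta_star mu P s)%E.
Proof. by rewrite /beta_star le_max lexx orbT. Qed.

End beta_star.

Theorem theorem27 (d : measure_display) (E : measurableType d) (R : realType)
    (mu : probability E R) (P : R.-pker E ~> E) (beta : R -> R)
    (mdiag : measurable (diagonal : set (E * E)))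
    (revP : reversible mu P) (wpiP : osc_WPI mu P beta)
    (s : R) (s_gt0 : 0 < s) :
  (beta_star mu P s <= (beta s)%:E)%E /\
  (ereal_sup [set (mu (sticky_set P eps)
                   * ((1 - s * eps)%:E - mu (sticky_set P eps)))%E
             | eps in [set eps : R | (0 < eps < 1)%R]]
     <= beta_star mu P s)%E.
Proof.
split; first exact: beta_star_le.
apply: ge_ereal_sup => _ /= [eps /andP[eps0 eps1] <-].
have mA := measurable_sticky_set P mdiag eps.
set A := sticky_set P eps in mA *.
have Efin : mu A = (fine (mu A))%:E by rewrite fineK// fin_num_measure.
(* When [mu A] is 0 or 1 the centred indicator is almost everywhere constant and cannot have
   oscillation 1. The claimed lower bound is then 0 or [- (s * eps)], and the truncation of
   [beta_star] at 0 suffices. *)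
have [mu0|muN0] := eqVneq (mu A) 0%E; first by rewrite mu0 mul0e beta_star_ge0.
have [mu1|muN1] := eqVneq (mu A) 1%E.
  rewrite mu1 mul1e -EFinB (le_trans _ (beta_star_ge0 _ _ _))// lee_fin.
  by rewrite addrAC subrr sub0r oppr_le0 mulr_ge0// ltW.
have mu_gt0 : (0 < mu A)%E by rewrite lt0e muN0 measure_ge0.
have mu_lt1 : (mu A < 1)%E by rewrite lt_neqAle muN1 probability_le1.
apply: le_trans (le_beta_star P s (centered_indic_L20 mu mA)
                   (osc_centered_indic mA mu_gt0 mu_lt1)).
have := dirichlet_sticky_le mdiag (fine (mu A)) eps revP.
rewrite Lnorm2_centered_indic// -/A Efin -EFinB -EFinM -EFinB lee_fin /=.
move: (dirichlet _ _ _) => e; move: (fine (mu A)) => p.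
move=> /(ler_wpM2l (ltW s_gt0)) se.
(* The target is the variance minus [s] times the energy bound [eps * p]. *)
have -> : p * (1 - s * eps - p) = p * (1 - p) - s * (eps * p) by ring.
by rewrite lerD2l lerN2.
Qed.
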